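(* Let $m\geq 1$ be an integer, let $\beta>1$ be the root of $x^2-mx-1$, and let $\mathbb{Z}_{-\beta}=\{t_j\mid j\in\mathbb{Z}\}$ with $t_0=0$ and $t_j<t_{j+1}$ for all $j$. Put $$\xi=\begin{cases}-\frac1\beta&\text{for } m\geq 2,\\ \frac1{\beta^2}&\text{for } m=1.\end{cases}$$ Then for all $j,k\in\mathbb{Z}$, $$t_j+t_k\in t_{j+k}+\{0,\xi\},\qquad t_j-t_k\in t_{j-k}-\{0,\xi\},$$ and $-t_j=t_{-j}-\xi$ for all $j\in\mathbb{Z}\setminus\{0\}$. Moreover, if $m\geq 2$, then for all $j,k\in\mathbb{Z}$, $t_j\oplus t_k$ is the closest element of $\mathbb{Z}_{-\beta}$ to $t_j+t_k$.
   Context: **$(-\beta)$-integers.** For $\beta>1$ let $l=-\frac{\beta}{\beta+1}$, $I=[l,l+1)$, $T(x)=-\beta x-\lfloor-\beta x-l\rfloor$ on $I$, and for $x\in I$ put $d_{-\beta}(x)=y_1y_2y_3\cdots$ with $y_i=\lfloor-\beta T^{i-1}(x)-l\rfloor$. For $x\in\mathbb{R}$ choose an integer $k\geq 0$ with $x/(-\beta)^k\in(l,l+1)$; if $d_{-\beta}(x/(-\beta)^k)=y_1y_2\cdots$, then $x\in\mathbb{Z}_{-\beta}$ if and only if $y_i=0$ for all $i>k$ (this does not depend on the choice of $k$). The operation $\oplus$ on $\mathbb{Z}_{-\beta}=\{t_j\mid j\in\mathbb{Z}\}$ is defined by $t_j\oplus t_k=t_{j+k}$. (The distances between consecutive elements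 of $\mathbb{Z}_{-\beta}$ take the values $\Delta_0^-=1$ and $\Delta_1^-$, where $\Delta_1^-=1+\frac1\beta$ for $m\geq 2$ and $\Delta_1^-=\frac1\beta$ for $m=1$; so $\xi=\Delta_0^--\Delta_1^-$.) *)

(* Defs.v *)
From mathcomp Require Import all_boot all_order all_algebra.
From mathcomp Require Import all_classical all_reals.

Set Implicit Arguments.
Unset Strict Implicit.
Unset Printing Implicit Defensive.

Import Order.TTheory GRing.Theory Num.Theory.

Local Open Scope classical_set_scope.
Local Open Scope ring_scope.

Definition lend (R : realType) (beta : R) : R := - (beta / (beta + 1)).

(* The (-beta)-transformation; the formula is only meaningful on
   [lend beta, lend beta + 1[, which it maps to itself. *)
Definition Tneg (R : realType) (beta x : R) : R :=
  - beta * x - (Num.floor (- beta * x - lend beta))%:~R.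

(* The i-th digit y_i of the (-beta)-expansion of x, for i >= 1. *)
Definition digit (R : realType) (beta x : R) (i : nat) : int :=
  Num.floor (- beta * iter i.-1 (Tneg beta) x - lend beta).

(* Replacing an admissible k by k.+1 only prepends the digit 0, so asking for
   some admissible k or for all of them makes no difference. *)
Definition neg_beta_integers (R : realType) (beta : R) : set R :=
  [set x | exists k : nat,
     lend beta < x / (- beta) ^+ k < lend beta + 1 /\
     forall i : nat, (k < i)%N -> digit beta (x / (- beta) ^+ k) i = 0].

Definition increasing_enumeration (R : realType) (A : set R) (t : int -> R) :=
  [/\ range t = A, t 0 = 0 & forall j : int, t j < t (j + 1)].

Definition oplus (R : realType) (t : int -> R) (x y : R) : R :=
  t (xget 0 [set j | t j = x] + xget 0 [set k | t k = y]).

Lemma oplusE (R : realType) (t : int -> R) (j k : int) :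
  injective t -> oplus t (t j) (t k) = t (j + k).
Proof.
move=> t_inj; have idxE i : xget 0 [set h | t h = t i] = i.
  by apply: t_inj; exact: (@xgetPex _ 0 [set h | t h = t i] (ex_intro _ i erefl)).
by rewrite /oplus !idxE.
Qed.

(* "The" closest element: the minimum distance is attained at c only. *)
Definition is_the_closest (R : realType) (A : set R) (x c : R) :=
  A c /\ forall z : R, A z -> z <> c -> `|x - c| < `|x - z|.

Definition xi (R : realType) (m : nat) (beta : R) : R :=
  if (2 <= m)%N then - beta^-1 else (beta ^+ 2)^-1.

(* Main.v *)
(* The (-beta)-integers form a cut-and-project set. Let x' be the Galois
   conjugate of x in Z[beta]; it turns the expansion sum d_j (-beta)^j into
   sum d_j beta^-j. Then Z_{-beta} = {x in Z[beta] | 0 <= x' < c}, with c = beta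
   if m >= 2 and c = beta^2 if m = 1. If x is a (-beta)-integer, its digits lie
   in {0, ..., m} and, for m >= 2, the last one is at most m - 1, which bounds
   the sum. Conversely, k steps of T on x / (-beta)^k leave a remainder u in
   [l, l + 1) with |u'| < beta + 1; only finitely many elements of Z[beta] are
   that small, and all but 0 are ruled out.
   The window description gives t_j = j - xi floor(j / c), and the statements
   follow from floor(x + y) - floor(x) - floor(y) in {0, 1} and from
   floor(-x) = - floor(x) - 1 for non-integral x. *)

Require Import Defs.
From mathcomp Require Import all_boot all_order all_algebra.
From mathcomp Require Import all_classical all_reals.
From mathcomp Require Import ring lra zify.

Set Implicit Arguments.
Unset Strict Implicit.
Unset Printing Implicit Defensive.

Import Order.TTheory GRing.Theory Num.Theory.
Local Open Scope classical_set_scope.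
Local Open Scope ring_scope.

(* y is the Galois conjugate of x in Z[beta], beta having conjugate -1/beta. *)
Definition conjugates (R : realType) (beta x y : R) : Prop :=
  exists a b : int, x = a%:~R + b%:~R * beta /\ y = a%:~R - b%:~R / beta.

(* The conjugate of the part of u (-beta)^n carried by its first n digits: the
   n-th digit has weight 1, the i-th one weight beta^(i-n). *)
Fixpoint digit_sum (R : realType) (beta u : R) (n : nat) : R :=
  if n is n'.+1 then digit_sum beta u n' / beta + (digit beta u n)%:~R else 0.

(** * Metallic means and their irrationality *)

Definition metallic_mean (R : realType) (m : nat) (beta : R) : Prop :=
  [/\ (0 < m)%N, 1 < beta & beta = m%:R + beta^-1].

Lemma metallic_meanE (R : realType) (m : nat) (beta : R)
    (beta_m : metallic_mean m beta) : m%:~R = beta - beta^-1.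
Proof. by have [_ _ betaE] := beta_m; rewrite [X in X - _]betaE addrK. Qed.

(* Descent: beta^-1 = beta - m, so b beta = - a makes b / beta an integer too,
   which is smaller than b in absolute value. *)
Lemma metallic_mean_irrational (R : realType) (m : nat) (beta : R)
    (beta_m : metallic_mean m beta) (a b : int) :
  a%:~R + b%:~R * beta = 0 -> b = 0.
Proof.
have [m_gt0 beta_gt1 betaE] := beta_m.
have b0 : 0 < beta by lra.
have [n] := ubnP `|b|%N; elim: n a b => // n IHn a b b_lt ab0.
have [//|bN0] := eqVneq b 0.
have g0 : 0 < beta^-1 by rewrite invr_gt0.
have g1 : beta^-1 < 1 by rewrite invf_lt1.
have beta_g : beta * beta^-1 = 1 by rewrite mulfV ?gt_eqF.
have gE : b%:~R * beta^-1 = (- a - b * m)%:~R :> R.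
  rewrite rmorphB rmorphN rmorphM /= (metallic_meanE beta_m).
  lra.
have : - a - b * m = 0.
  apply: (IHn (- b)); last first.
    by rewrite -gE -mulrA [_^-1 * _]mulrC beta_g mulr1 rmorphN addNr.
  rewrite -ltnS; apply: leq_trans b_lt.
  rewrite ltnS -ltz_nat !abszE -(ltr_int R) !intr_norm -gE normrM.
  by rewrite (gtr0_norm g0) gtr_pMr // normr_gt0 intr_eq0.
move=> q0; move: gE; rewrite q0 => /eqP; rewrite mulf_eq0 intr_eq0 (negbTE bN0) /=.
by rewrite gt_eqF.
Qed.

(** * Galois conjugation on Z[beta] *)

(** Both coefficients vanish, as beta is irrational. *)
Lemma conjugates0 (R : realType) (m : nat) (beta : R)
    (beta_m : metallic_mean m beta) (y : R) : conjugates beta 0 y -> y = 0.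
Proof.
move=> [a [b [/esym ab0 ->]]]; have b0 := metallic_mean_irrational beta_m ab0.
by move: ab0; rewrite b0 mul0r addr0 mul0r subr0.
Qed.

Lemma conjugates_int (R : realType) (beta : R) (d : int) :
  conjugates beta d%:~R d%:~R.
Proof. by exists d, 0; rewrite !mul0r addr0 subr0. Qed.

Lemma conjugatesD (R : realType) (beta : R) (x y x' y' : R) :
  conjugates beta x y -> conjugates beta x' y' -> conjugates beta (x + x') (y + y').
Proof.
move=> [a [b [-> ->]]] [a' [b' [-> ->]]]; exists (a + a'), (b + b').
by rewrite !rmorphD /=; split; ring.
Qed.

(** The conjugate of -beta is 1/beta; the new coefficients come from beta^2 = m beta + 1. *)
Lemma conjugatesM (R : realType) (m : nat) (beta : R)
    (beta_m : metallic_mean m beta) (x y : R) :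
  conjugates beta x y -> conjugates beta (- beta * x) (y / beta).
Proof.
have [m_gt0 beta_gt1 betaE] := beta_m.
have b0 : beta != 0 by rewrite gt_eqF //; lra.
move=> [a [b [-> ->]]]; exists (- b), (- a - b * m).
rewrite rmorphB !rmorphN rmorphM /= (metallic_meanE beta_m).
by split; field.
Qed.

Lemma conjugatesV (R : realType) (m : nat) (beta : R)
    (beta_m : metallic_mean m beta) (x y : R) :
  conjugates beta x y -> conjugates beta (x / - beta) (beta * y).
Proof.
have [m_gt0 beta_gt1 betaE] := beta_m.
have b0 : beta != 0 by rewrite gt_eqF //; lra.
move=> [a [b [-> ->]]]; exists (a * m - b), (- a).
rewrite rmorphB !rmorphN rmorphM /= (metallic_meanE beta_m).
by split; field.
Qed.

Lemma conjugatesMn (R : realType) (m : nat) (beta : R)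
    (beta_m : metallic_mean m beta) (x y : R) k :
  conjugates beta x y -> conjugates beta ((- beta) ^+ k * x) (y / beta ^+ k).
Proof.
move=> cxy; elim: k => [|k IHk]; first by rewrite expr0 mul1r invr1 mulr1.
rewrite !exprS -mulrA invfM [beta^-1 * _]mulrC [y * _]mulrA.
exact: (conjugatesM beta_m).
Qed.

Lemma conjugatesVn (R : realType) (m : nat) (beta : R)
    (beta_m : metallic_mean m beta) (x y : R) k :
  conjugates beta x y -> conjugates beta (x / (- beta) ^+ k) (beta ^+ k * y).
Proof.
move=> cxy; elim: k => [|k IHk]; first by rewrite expr0 mul1r invr1 mulr1.
rewrite !exprS -mulrA invfM [_^-1 * _]mulrC [x * _]mulrA.
exact: (conjugatesV beta_m).
Qed.

(** * Growth of powers and bounds on the constants *)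

Lemma expr_unbounded (R : realType) (beta : R) (beta_gt1 : 1 < beta) (e M : R) :
  0 < e -> exists k, M < e * beta ^+ k.
Proof.
move=> e0; have e'0 : 0 < e * (beta - 1) by rewrite mulr_gt0 // subr_gt0.
exists (Num.trunc (M / (e * (beta - 1)))).+1.
have := truncnS_gt (M / (e * (beta - 1))).
move: (Num.trunc _).+1 => k; rewrite ltr_pdivrMr // => /lt_le_trans; apply.
(* Bernoulli's inequality, by induction on [k]. *)
rewrite mulrCA ler_pM2l //; suff : 1 + k%:R * (beta - 1) <= beta ^+ k by lra.
elim: k => [|k IHk]; first by rewrite mul0r addr0.
have k0 : 0 <= k%:R :> R by [].
rewrite exprS -natr1.
have : beta * (1 + k%:R * (beta - 1)) <= beta * beta ^+ k by rewrite ler_pM2l //; lra.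
apply: le_trans; rewrite -subr_ge0.
have : 0 <= k%:R * (beta - 1) ^+ 2 by rewrite mulr_ge0 // sqr_ge0.
by move=> /le_trans; apply; rewrite le_eqVlt; apply/orP; left; apply/eqP; ring.
Qed.

(** With h = 1/(beta + 1), the interval [l, l + 1) is [h - 1, h), the form used in the estimates. *)
Lemma lendE (R : realType) (beta : R) (beta_gt1 : 1 < beta) :
  lend beta = (beta + 1)^-1 - 1.
Proof. by rewrite /lend; field; rewrite gt_eqF //; lra. Qed.

Lemma inv_bounds (R : realType) (m : nat) (beta : R)
    (beta_m : metallic_mean m beta) :
  [/\ 0 < (beta + 1)^-1, (beta + 1)^-1 < beta^-1, (beta + 1)^-1 < 2^-1,
      beta^-1 + (beta + 1)^-1 <= 1 &
      beta * beta^-1 = 1 /\ (beta + 1) * (beta + 1)^-1 = 1].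
Proof.
have [m_gt0 beta_gt1 betaE] := beta_m.
have b0 : 0 < beta by lra.
have b10 : 0 < beta + 1 by lra.
have bg : beta * beta^-1 = 1 by rewrite mulfV ?gt_eqF.
split; rewrite ?invr_gt0 ?ltf_pV2 ?posrE //; try lra;
  last by split=> //; rewrite mulfV ?gt_eqF.
rewrite -subr_ge0.
(* The numerator equals (m - 1) beta, since beta^2 = m beta + 1. *)
rewrite (_ : _ - _ = (beta ^+ 2 - beta - 1) / (beta * (beta + 1))); last first.
  by field; rewrite !gt_eqF.
apply: divr_ge0; last by rewrite ltW // mulr_gt0.
have m1 : 1 <= m%:R :> R by rewrite ler1n.
by rewrite expr2 {1}betaE; nra.
Qed.

(** * Orbits, digits and digit sums *)

Lemma Tneg_itv (R : realType) (beta u : R) :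
  lend beta <= Tneg beta u < lend beta + 1.
Proof.
have := floor_itv (- beta * u - lend beta); rewrite rmorphD /= /Tneg.
by move: (Num.floor _)%:~R => f; lra.
Qed.

Lemma iter_Tneg_itv (R : realType) (beta u : R) n :
  lend beta <= u < lend beta + 1 ->
  lend beta <= iter n (Tneg beta) u < lend beta + 1.
Proof. by case: n => // n _; exact: Tneg_itv. Qed.

Lemma iter_TnegS (R : realType) (beta u : R) (n : nat) :
  iter n.+1 (Tneg beta) u = - beta * iter n (Tneg beta) u - (digit beta u n.+1)%:~R.
Proof. by []. Qed.

(** For v in [l, l + 1), -beta v - l lies in (0, beta], and beta < m + 1. *)
Lemma digit_bounds (R : realType) (m : nat) (beta : R)
    (beta_m : metallic_mean m beta) (u : R) n :
  lend beta <= u < lend beta + 1 ->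
  0 <= digit beta u n.+1 <= m.
Proof.
have [m_gt0 beta_gt1 betaE] := beta_m.
move=> /(iter_Tneg_itv n); rewrite /digit /=; move: (iter _ _ _) => v.
have [h0 hg h2 gh [bg bh]] := inv_bounds beta_m; rewrite (lendE beta_gt1) => v_itv.
set y := _ - _; have := floor_itv y; set d := Num.floor y => d_itv.
have g1 : beta^-1 < 1 by lra.
have y0 : 0 < y by rewrite /y; nra.
have ym : y < m%:R + 1 by apply: (@le_lt_trans _ _ beta); [rewrite /y; nra|lra].
have : -1 < d%:~R :> R by rewrite rmorphD /= in d_itv; lra.
have : d%:~R < m%:R + 1 :> R by lra.
rewrite -[_ + 1](natrD _ _ 1%N) -[(m + 1)%:R]/((Posz (m + 1))%:~R).
rewrite -[-1]/((-1)%:~R) !ltr_int.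
by clear; lia.
Qed.

(** Digits are at most m, and beta + 1 is the fixed point of S -> S / beta + m. *)
Lemma digit_sum_bounds (R : realType) (m : nat) (beta : R)
    (beta_m : metallic_mean m beta) (u : R) n :
  lend beta <= u < lend beta + 1 ->
  0 <= digit_sum beta u n < beta + 1.
Proof.
have [m_gt0 beta_gt1 betaE] := beta_m.
move=> u_itv; elim: n => [|n /andP[IH0 IH1]] /=; first by apply/andP; split; lra.
have /andP[d0 dm] := digit_bounds beta_m n u_itv.
have {d0} : 0 <= (digit beta u n.+1)%:~R :> R by rewrite ler0z.
have {dm} : (digit beta u n.+1)%:~R <= m%:R :> R.
  by rewrite -[m%:R]/((Posz m)%:~R) ler_int.
move: (digit _ _ _)%:~R => d; have [h0 hg h2 gh [bg bh]] := inv_bounds beta_m.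
move: (digit_sum _ _ _) IH0 IH1 => S S0 S1 dm d0.
have : 0 <= S / beta < 1 + beta^-1 by apply/andP; split; nra.
by lra.
Qed.

(** A step of T multiplies by -beta and subtracts a digit; its conjugate divides by beta and
    subtracts the same digit. *)
Lemma conjugates_iter (R : realType) (m : nat) (beta : R)
    (beta_m : metallic_mean m beta) (u v : R) n :
  conjugates beta u v ->
  conjugates beta (iter n (Tneg beta) u) (v / beta ^+ n - digit_sum beta u n).
Proof.
move=> cuv; elim: n => [|n IHn]; first by rewrite expr0 divr1 subr0.
rewrite iterS /= exprSr invfM.
rewrite (_ : _ - _ = (v / beta ^+ n - digit_sum beta u n) / beta +
   (- digit beta u n.+1)%:~R); last by rewrite rmorphN /=; ring.
rewrite (_ : Tneg _ _ = - beta * iter n (Tneg beta) u +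
   (- digit beta u n.+1)%:~R); last by rewrite rmorphN.
by apply: conjugatesD; [exact: (conjugatesM beta_m)|exact: conjugates_int].
Qed.

(** Since beta is a unit, membership in Z[beta] can be pulled back along the orbit. *)
Lemma iter_conjugates (R : realType) (m : nat) (beta : R)
    (beta_m : metallic_mean m beta) (u v : R) n :
  conjugates beta (iter n (Tneg beta) u) v ->
  exists w, conjugates beta u w.
Proof.
have [m_gt0 beta_gt1 betaE] := beta_m.
have b0 : beta != 0 by rewrite gt_eqF //; lra.
elim: n v => [|n IHn] v; first by exists v.
rewrite iterS => cv; apply: IHn (beta * (v + (digit beta u n.+1)%:~R)) _.
rewrite (_ : iter n _ _ =
   (Tneg beta (iter n (Tneg beta) u) + (digit beta u n.+1)%:~R) / - beta).
  by apply: (conjugatesV beta_m); apply: conjugatesD => //; exact: conjugates_int.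
by rewrite /Tneg /digit /= subrK [- _ * _]mulrC mulfK // oppr_eq0.
Qed.

(** * Characterization of (-beta)-integers by the window *)

(** If u = a + b beta, then u - v = b (beta + 1/beta), which the bounds restrict to |b| < 2; the
    position of u then leaves few values of a. *)
Lemma remainder_cases (R : realType) (m : nat) (beta : R)
    (beta_m : metallic_mean m beta) (u v : R) : conjugates beta u v ->
    lend beta <= u < lend beta + 1 -> - (beta + 1) < v < beta + 1 ->
  u = 0 \/ u = - beta^-1 /\ v = beta.
Proof.
have [m_gt0 beta_gt1 betaE] := beta_m.
have [h0 hg h2 gh [bg bh]] := inv_bounds beta_m.
rewrite (lendE beta_gt1) => - [a [b [uE vE]]] u_itv v_itv.
have uvE : u - v = b%:~R * (beta + beta^-1) by rewrite uE vE; ring.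
have bg2 : 2 < beta + 2 * beta^-1 by nra.
have s0 : 0 < beta + beta^-1 by lra.
have b_lt : b%:~R < 2%:~R :> R by rewrite -(ltr_pM2r s0) -uvE; lra.
have b_gt : (-2)%:~R < b%:~R :> R by rewrite -(ltr_pM2r s0) -uvE; lra.
move: b_lt b_gt; rewrite !ltr_int => b_lt b_gt.
have [b1|[b0|b1]] : b = 1 \/ b = 0 \/ b = -1 by clear -b_lt b_gt; lia.
(* This value of a gives v = -(beta + 1), an excluded endpoint. *)
- suff aE : a = - (m%:Z + 1).
    by move: v_itv; rewrite vE aE b1 rmorphN rmorphD /= mul1r; lra.
  have : (a + m)%:~R < 0%:~R :> R by rewrite rmorphD /=; move: uE; rewrite b1; lra.
  have : (-2)%:~R < (a + m)%:~R :> R by rewrite rmorphD /=; move: uE; rewrite b1; lra.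
  by rewrite !ltr_int; clear; lia.
- left; suff aE : a = 0 by rewrite uE b0 aE mul0r addr0.
  have : a%:~R < 1%:~R :> R by move: uE; rewrite b0; lra.
  have : (-1)%:~R < a%:~R :> R by move: uE; rewrite b0; lra.
  by rewrite !ltr_int; clear; lia.
- right; suff aE : a = m by move: uE vE; rewrite aE b1; lra.
  have : (a - m%:Z)%:~R < 1%:~R :> R by rewrite rmorphB /=; move: uE; rewrite b1; lra.
  have : (-1)%:~R < (a - m%:Z)%:~R :> R by rewrite rmorphB /=; move: uE; rewrite b1; lra.
  by rewrite !ltr_int; clear; lia.
Qed.

(* beta + 1 stands for beta^2, to which it is equal when m = 1. *)
Definition window (R : realType) (m : nat) (beta : R) : R :=
  if (2 <= m)%N then beta else beta + 1.

Lemma Tneg0 (R : realType) (m : nat) (beta : R)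
    (beta_m : metallic_mean m beta) :
  Tneg beta 0 = 0.
Proof.
have [h0 hg h2 gh [bg bh]] := inv_bounds beta_m; have [_ beta_gt1 _] := beta_m.
have fl : Num.floor (- lend beta) = 0.
  by apply: floor_def; rewrite lendE // add0r; lra.
by rewrite /Tneg mulr0 !sub0r fl oppr0.
Qed.

(** While the digits are 0, T is multiplication by -beta, so a nonzero remainder would leave the
    bounded interval. Conversely, T fixes 0 and its digits are 0. *)
Lemma zero_digits (R : realType) (m : nat) (beta : R)
    (beta_m : metallic_mean m beta) (u : R) (k : nat) :
  lend beta <= u < lend beta + 1 ->
  (forall i, (k < i)%N -> digit beta u i = 0) <-> iter k (Tneg beta) u = 0.
Proof.
have [m_gt0 beta_gt1 betaE] := beta_m.
have b0 : 0 < beta by lra.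
have [h0 hg h2 gh [bg bh]] := inv_bounds beta_m.
move=> u_itv; split=> [dig0|uk0 i]; last first.
  rewrite -subn_gt0 => ki.
  rewrite /digit (_ : i.-1 = (i - k).-1 + k)%N; last by clear -ki; lia.
  rewrite iterD uk0 (_ : iter _ _ 0 = 0); last first.
    by elim: (_.-1) => // n IHn; rewrite iterS IHn (Tneg0 beta_m).
  apply: floor_def; rewrite mulr0 sub0r lendE // add0r; lra.
apply/eqP/negPn/negP => uk0; set v := iter _ _ _ in uk0.
have v0 : 0 < `|v| by rewrite normr_gt0.
have [i] := expr_unbounded beta_gt1 1 v0.
have vE : v * (- beta) ^+ i = iter (i + k) (Tneg beta) u.
  elim: i => [|i IHi]; first by rewrite expr0 mulr1.
  rewrite exprSr mulrA IHi addSn iterS /Tneg.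
  have := dig0 (i + k).+1; rewrite ltnS leq_addl /digit /= => -> //.
  by rewrite subr0 mulrC.
rewrite -[X in _ < _ * X ^+ _](gtr0_norm b0).
rewrite -[X in _ < _ * X ^+ _]normrN -normrX -normrM vE.
have := iter_Tneg_itv (i + k) u_itv; rewrite lendE // => w_itv.
by rewrite ltNge => /negP; apply; rewrite ler_norml; lra.
Qed.

Lemma window_digit_sum (R : realType) (m : nat) (beta : R)
    (beta_m : metallic_mean m beta) (u : R) (k : nat) :
  lend beta <= u < lend beta + 1 ->
  iter k (Tneg beta) u = 0 -> digit_sum beta u k < window m beta.
Proof.
have [m_gt0 beta_gt1 betaE] := beta_m.
have [h0 hg h2 gh [bg bh]] := inv_bounds beta_m.
move=> u_itv; rewrite /window; case: ifPn => [m2|_ _]; last first.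
  by have /andP[] := digit_sum_bounds beta_m k u_itv.
(* For m >= 2 the last digit cannot be m, as -m/beta lies below the interval. *)
case: k => [_|k]; first by rewrite /=; lra.
have := iter_Tneg_itv k u_itv; have := digit_sum_bounds beta_m k u_itv.
rewrite iter_TnegS /= lendE //.
move: (iter _ _ _) (digit_sum _ _ _) (digit _ _ _) => v S d S_itv v_itv /eqP.
rewrite subr_eq0 => /eqP dE; have m2R : 2%:R <= m%:R :> R by rewrite ler_nat.
have g2 : 2 * beta^-1 <= 1 by rewrite -bg ler_pM2r ?invr_gt0; lra.
have b0 : 0 < beta by lra.
have v_ge : beta * ((beta + 1)^-1 - 1) <= beta * v by rewrite ler_pM2l //; lra.
have : d%:~R < m%:~R :> R by rewrite -dE /=; lra.
rewrite ltr_int => dm.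
have : d%:~R <= (m%:Z - 1)%:~R :> R by rewrite ler_int; clear -dm; lia.
rewrite rmorphB /=.
have : S / beta < 1 + beta^-1.
  by rewrite ltr_pdivrMr // mulrDl mul1r mulVf ?gt_eqF //; lra.
lra.
Qed.

Lemma neg_beta_integersP (R : realType) (m : nat) (beta : R)
    (beta_m : metallic_mean m beta) (x : R) : neg_beta_integers beta x <->
  exists y, conjugates beta x y /\ 0 <= y < window m beta.
Proof.
have [m_gt0 beta_gt1 betaE] := beta_m.
have [h0 hg h2 gh [bg bh]] := inv_bounds beta_m.
have b0 : 0 < beta by lra.
split=> [[k [u_itv']]|[y [cxy y_itv]]].
  have u_itv : lend beta <= x / (- beta) ^+ k < lend beta + 1.
    by case/andP: u_itv' => /ltW -> ->.
  rewrite (zero_digits beta_m k u_itv) => uk0.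
  have [w cw] : exists w, conjugates beta (x / (- beta) ^+ k) w.
    apply: (iter_conjugates beta_m (n := k) (v := 0)).
    by rewrite uk0; exact: (conjugates_int _ 0).
  exists (w / beta ^+ k); split.
    have := conjugatesMn beta_m k cw; rewrite mulrCA mulfV ?mulr1 //.
    by rewrite expf_neq0 // oppr_eq0 gt_eqF.
  (* The remainder 0 has conjugate 0, so the conjugate of x is the digit sum. *)
  have := conjugates_iter beta_m k cw; rewrite uk0 => /(conjugates0 beta_m)/eqP.
  rewrite subr_eq0 => /eqP ->; rewrite window_digit_sum // andbT.
  by have /andP[] := digit_sum_bounds beta_m k u_itv.
(* As h < 1/2, |u| < h puts u inside (l, l + 1). The exponent [k.+1] ensures that there is a last
   step of T to unfold when m = 1. *)
have [k xk] := expr_unbounded beta_gt1 `|x| h0.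
have b0k : 0 < beta ^+ k.+1 by rewrite exprn_gt0.
have uk : `|x / (- beta) ^+ k.+1| < (beta + 1)^-1.
  rewrite normrM normfV normrX normrN (gtr0_norm b0) ltr_pdivrMr //.
  by apply: lt_trans xk _; rewrite ltr_pM2l // exprS ltr_pMl // exprn_gt0.
have u_itv : lend beta < x / (- beta) ^+ k.+1 < lend beta + 1.
  by move: uk; rewrite ltr_norml lendE //; lra.
exists k.+1; split=> //.
have {u_itv} u_itv : lend beta <= x / (- beta) ^+ k.+1 < lend beta + 1.
  by case/andP: u_itv => /ltW -> ->.
apply/(zero_digits beta_m _ u_itv).
(* The remainder has conjugate y - S, with S the digit sum; the bounds on y and S give |y - S| <
   beta + 1. *)
have := conjugates_iter beta_m k.+1 (conjugatesVn beta_m k.+1 cxy).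
rewrite [beta ^+ _ * y]mulrC mulfK ?gt_eqF // => cvz.
have S_itv := digit_sum_bounds beta_m k.+1 u_itv.
have c_le : window m beta <= beta + 1 by rewrite /window; case: ifP => _; lra.
have v_itv := iter_Tneg_itv k.+1 u_itv.
case: (remainder_cases beta_m cvz v_itv) => // [|[vE yE]]; first lra.
move: y_itv; rewrite /window; case: ifPn => [_|]; first lra.
rewrite -ltnNge => m_lt2 /andP[_ y_lt].
have m1 : m%:R = 1 :> R by have -> : m = 1%N by clear -m_gt0 m_lt2; lia.
(* For m = 1, the remainder -1/beta is the left end of the interval; it is only
   reached by the digit 1, which makes the digit sum at least 1. *)
have := iter_Tneg_itv k u_itv; have := digit_sum_bounds beta_m k u_itv.
move: vE yE; rewrite iter_TnegS /= lendE //.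
move: (iter _ _ _) (digit_sum _ _ _) (digit _ _ _) => v S d vE yE S_itv' w_itv.
have gh1 : beta^-1 + (beta + 1)^-1 = 1.
  apply: (@mulfI _ (beta + 1)); first by rewrite gt_eqF //; lra.
  by rewrite mulrDr mulr1 mulrDl mul1r bg bh; lra.
have v_lt : beta * v < beta * (beta + 1)^-1 by rewrite ltr_pM2l //; lra.
have : 0 < d%:~R :> R by lra.
rewrite ltr0z => d0.
have : 1%:~R <= d%:~R :> R by rewrite ler_int; clear -d0; lia.
have : 0 <= S / beta by rewrite divr_ge0 //; lra.
by lra.
Qed.

(** * Explicit formula for the (-beta)-integers *)

(** The window length c is the conjugate of xi = r - beta, with r = m if m >= 2 and r = 2 if m =
    1. *)
Lemma window_xi (R : realType) (m : nat) (beta : R)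
    (beta_m : metallic_mean m beta) :
  exists r : int,
    - xi m beta = beta - r%:~R /\ window m beta = r%:~R + beta^-1.
Proof.
have [m_gt0 beta_gt1 betaE] := beta_m.
rewrite /xi /window; case: ifPn => [m2|m_lt2].
  by exists m; rewrite opprK {2}betaE addrAC subrr add0r.
have m1 : m%:R = 1 :> R by have -> : m = 1%N by clear -m_gt0 m_lt2; lia.
have betaE' := betaE; rewrite m1 in betaE'.
exists 2; split; last by rewrite [in LHS]betaE'; lra.
have b0 : beta != 0 by rewrite gt_eqF //; lra.
have bb : beta * beta = beta + 1.
  by rewrite [in X in _ * X]betaE' mulrDr mulr1 mulfV.
apply: (@mulfI _ (beta ^+ 2)); first by rewrite expf_neq0.
by rewrite mulrN mulfV ?expf_neq0 // expr2 bb mulrBr mulrDl bb mul1r; lra.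
Qed.

Lemma window_gt1 (R : realType) (m : nat) (beta : R)
    (beta_m : metallic_mean m beta) :
  1 < window m beta.
Proof. by have [_ beta_gt1 _] := beta_m; rewrite /window; case: ifP => _; lra. Qed.

Lemma xi_lt1 (R : realType) (m : nat) (beta : R)
    (beta_m : metallic_mean m beta) :
  xi m beta < 1.
Proof.
have [_ beta_gt1 _] := beta_m; have b0 : 0 < beta by lra.
have g0 : 0 < beta^-1 by rewrite invr_gt0.
rewrite /xi; case: ifP => _; first by lra.
by rewrite invf_lt1 ?exprn_gt0 // exprn_egt1.
Qed.

(** Its conjugate is j - c floor(j / c), the residue of j modulo c in [0, c). *)
Definition neg_beta_integer (R : realType) (m : nat) (beta : R) (j : int) : R :=
  j%:~R - xi m beta * (Num.floor (j%:~R / window m beta))%:~R.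

Lemma range_neg_beta_integer (R : realType) (m : nat) (beta : R)
    (beta_m : metallic_mean m beta) :
  range (neg_beta_integer m beta) = neg_beta_integers beta.
Proof.
have c0 : 0 < window m beta by have := window_gt1 beta_m; lra.
have [r [xiN cE]] := window_xi beta_m.
have xiE : xi m beta = r%:~R - beta by lra.
apply/seteqP; split=> x /=; rewrite (neg_beta_integersP beta_m).
  move=> [j _ <-]; rewrite /neg_beta_integer; set n := Num.floor _.
  exists (j%:~R - n%:~R * window m beta); split.
    exists (j - r * n), n; rewrite rmorphB rmorphM /= xiE cE.
    by split; ring.
  have := floor_itv (j%:~R / window m beta); rewrite -/n rmorphD /=.
  by rewrite ler_pdivlMr // ltr_pdivrMr // mulrDl; lra.
(* With j = a + r b, the number is j - b xi and its conjugate j - b c; the window condition says b =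
   floor(j / c). *)
move=> [y [[a [b [-> ->]]]]] y_itv; exists (a + r * b) => //.
rewrite /neg_beta_integer (@floor_def _ _ b).
  by rewrite xiE rmorphD rmorphM /=; ring.
rewrite ler_pdivlMr // ltr_pdivrMr // !rmorphD rmorphM /= mulrDl mul1r.
by move: y_itv; rewrite cE; lra.
Qed.

(** * Uniqueness of increasing enumerations *)

Lemma increasing_int (R : realType) (t : int -> R) :
  (forall j, t j < t (j + 1)) -> {mono t : i j / i < j}.
Proof.
move=> t_lt; have lt_n n i : t i < t (i + n.+1%:Z).
  elim: n => [|n IHn]; first exact: t_lt.
  apply: lt_trans IHn _; rewrite (_ : i + n.+2%:Z = i + n.+1%:Z + 1) //.
  by clear; lia.
have t_homo i j : i < j -> t i < t j.
  move=> ij; rewrite (_ : j = i + `|j - i|%N.-1.+1%:Z) //; clear -ij; lia.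
by move=> i j; case: (ltgtP i j) => [/t_homo|/t_homo/ltW/le_gtF|->].
Qed.

(** The change of index [f] is an increasing bijection of the integers fixing 0, hence the
    identity. *)
Lemma increasing_enumeration_unique (R : realType) (A : set R) (s t : int -> R) :
  increasing_enumeration A s -> increasing_enumeration A t -> t =1 s.
Proof.
move=> [sA s0 /increasing_int s_lt] [tA t0 /increasing_int t_lt].
have s_inj : injective s.
  by move=> i j sij; case: (ltgtP i j) => //; rewrite -s_lt sij ltxx.
have /boolp.choice[f fE] : forall j, exists i, t j = s i.
  move=> j.
  have : range s (t j) by rewrite sA -tA; exists j.
  by move=> [i _ <-]; exists i.
have f_lt : {mono f : i j / i < j} by move=> i j; rewrite -s_lt -!fE.
have f_surj i : exists j, f j = i.
  have : range t (s i) by rewrite tA -sA; exists i.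
  by move=> [j _]; rewrite fE => /s_inj; exists j.
(* The preimage i of f j + 1 exceeds j; if f (j + 1) were larger than f j + 1, i would lie strictly
   between j and j + 1. *)
have fS j : f (j + 1) = f j + 1.
  have [i fi] := f_surj (f j + 1).
  have ji : j < i by rewrite -f_lt fi; clear; lia.
  have := f_lt j (j + 1); have := f_lt i (j + 1); rewrite fi; clear -ji; lia.
have f0 : f 0 = 0 by apply: s_inj; rewrite -fE t0 s0.
move=> j; rewrite fE; congr s; elim/int_ind: j => // n IHn.
  by rewrite -addn1 PoszD fS IHn.
have := fS (- n.+1%:Z); rewrite (_ : - n.+1%:Z + 1 = - n%:Z); last by clear; lia.
by rewrite IHn; clear; lia.
Qed.

(** * Floor identities and the enumeration *)

Lemma floorD_cases (R : realType) (x y : R) (f := @Num.floor R) :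
  f (x + y) = f x + f y \/ f (x + y) = f x + f y + 1.
Proof.
have := floor_itv x; have := floor_itv y; have := floor_itv (x + y).
rewrite -/f !rmorphD /= => xy_itv y_itv x_itv.
have : (f x + f y)%:~R < (f (x + y) + 1)%:~R :> R by rewrite !rmorphD /=; lra.
have : (f (x + y))%:~R < (f x + f y + 2)%:~R :> R by rewrite !rmorphD /=; lra.
by rewrite !ltr_int; clear; lia.
Qed.

Lemma floorN (R : realType) (x : R) : (Num.floor x)%:~R != x ->
  Num.floor (- x) = - Num.floor x - 1.
Proof.
have := floor_itv x; rewrite rmorphD /= => x_itv; rewrite neq_lt => x_neq.
by apply: floor_def; rewrite !rmorphD !rmorphN /=; lra.
Qed.

(** As 1/c < 1, the floor grows by 0 or 1 at each step, so the gaps are 1 and 1 - xi, both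
    positive. *)
Lemma neg_beta_integer_enum (R : realType) (m : nat) (beta : R)
    (beta_m : metallic_mean m beta) :
  increasing_enumeration (neg_beta_integers beta) (neg_beta_integer m beta).
Proof.
have c1 := window_gt1 beta_m; have xi1 := xi_lt1 beta_m.
have c0 : 0 < (window m beta)^-1 by rewrite invr_gt0; lra.
have c_lt1 : (window m beta)^-1 < 1 by rewrite invf_lt1 //; lra.
split; first exact: range_neg_beta_integer.
  by rewrite /neg_beta_integer mul0r floor0 mulr0 subr0.
move=> j; rewrite /neg_beta_integer rmorphD /= mulrDl mul1r.
have fl1 : Num.floor (window m beta)^-1 = 0.
  by apply: floor_def; rewrite add0r; lra.
by case: (floorD_cases (j%:~R / window m beta) (window m beta)^-1) => ->;
  rewrite fl1 addr0 ?rmorphD /=; lra.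
Qed.

(** * Sums, differences and closest elements *)

Lemma metallic_mean_root (R : realType) (m : nat) (beta : R) :
  (1 <= m)%N -> 1 < beta -> root ('X^2 - m%:R *: 'X - 1) beta ->
  metallic_mean m beta.
Proof.
move=> m_ge1 beta_gt1; rewrite rootE !hornerE => /eqP beta2; split=> //.
have b0 : beta != 0 by rewrite gt_eqF //; lra.
by apply: (mulfI b0); rewrite mulrDr mulfV //; lra.
Qed.

Theorem proposition5p6 (R : realType) (m : nat) (beta : R) (t : int -> R)
    (m_ge1 : (1 <= m)%N)
    (beta_gt1 : 1 < beta)
    (beta_root : root ('X^2 - m%:R *: 'X - 1) beta)
    (t_enum : increasing_enumeration (neg_beta_integers beta) t) :
  [/\ (forall j k : int,
         [set t (j + k) + d | d in [set 0; xi m beta]] (t j + t k)),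
      (forall j k : int,
         [set t (j - k) - d | d in [set 0; xi m beta]] (t j - t k)),
      (forall j : int, j <> 0 -> - t j = t (- j) - xi m beta) &
      ((2 <= m)%N -> forall j k : int,
         is_the_closest (neg_beta_integers beta) (t j + t k)
           (oplus t (t j) (t k)))].
Proof.
have beta_m := metallic_mean_root m_ge1 beta_gt1 beta_root.
have [_ _ betaE] := beta_m.
have tE := increasing_enumeration_unique (neg_beta_integer_enum beta_m) t_enum.
have c0 : 0 < window m beta by have := window_gt1 beta_m; lra.
pose N (j : int) := Num.floor (j%:~R / window m beta).
have {}tE j : t j = j%:~R - xi m beta * (N j)%:~R by rewrite tE.
have ND j k : N (j + k) = N j + N k \/ N (j + k) = N j + N k + 1.
  by rewrite /N rmorphD /= mulrDl; exact: floorD_cases.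
(* The carry of the floor contributes one xi. *)
have tD j k : t j + t k = t (j + k) \/ t j + t k = t (j + k) + xi m beta.
  by rewrite !tE; case: (ND j k) => ->; [left|right]; rewrite !rmorphD /=; lra.
split=> [j k|j k|j /eqP j0|m2 j k].
- by case: (tD j k) => ->; [exists 0|exists (xi m beta)]; rewrite ?addr0 //=; [left|right].
(* The difference follows from the sum (j - k) + k = j. *)
- have := tD (j - k) k; rewrite subrK => -[] tjk; [exists 0|exists (xi m beta)] => /=;
    by [left|right|lra].
(* For j <> 0, j / c is not an integer: j = N j (r + 1/beta) and 1/beta = beta - m would force N j =
   0, then j = 0. *)
- have NN : N (- j) = - N j - 1.
    rewrite /N rmorphN mulNr; apply: floorN; rewrite -/(N j).
    have [r [_ cE]] := window_xi beta_m; rewrite cE in c0.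
    apply: contra_neq j0; rewrite cE => NjE.
    have jE : j%:~R - (N j)%:~R * (r%:~R + beta^-1) = 0.
      by rewrite NjE divfK ?subrr // gt_eqF.
    have N0 : - N j = 0.
      apply: (metallic_mean_irrational beta_m (a := j - N j * r + N j * m)).
      rewrite !rmorphD !rmorphN !rmorphM /=
        (metallic_meanE beta_m).
      lra.
    have {}N0 : N j = 0 by clear -N0; lia.
    by move: jE; rewrite N0 mul0r subr0 => /eqP; rewrite intr_eq0 => /eqP.
  by rewrite !tE NN rmorphB !rmorphN /=; lra.
have [tA _ t_lt] := t_enum.
have t_mono := increasing_int t_lt.
have t_inj : injective t.
  by move=> i i' tii; case: (ltgtP i i') => //; rewrite -t_mono tii ltxx.
rewrite oplusE //; split; first by rewrite -tA; exists (j + k).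
(* Now |xi| = 1/beta < 1/2: the sum is within 1/2 of t (j + k), while distinct elements are at least
   1 apart. *)
have b2 : 2 < beta.
  have : 0 < beta^-1 by rewrite invr_gt0; lra.
  have : 2%:R <= m%:R :> R by rewrite ler_nat.
  lra.
have xi_itv : - 2^-1 < xi m beta < 0.
  by rewrite /xi m2 ltrN2 ltf_pV2 ?posrE ?oppr_lt0 ?invr_gt0; lra.
(* [N] is monotone and -xi > 0, so the floor term only widens the gap. *)
have gap i i' : i < i' -> 1 <= t i' - t i.
  move=> ii'; have N_le : (N i)%:~R <= (N i')%:~R :> R.
    by rewrite ler_int le_floor // ler_pM2r ?invr_gt0 // ler_int ltW.
  have i_le : (i + 1)%:~R <= i'%:~R :> R by rewrite ler_int; clear -ii'; lia.
  have : 0 <= - xi m beta * ((N i')%:~R - (N i)%:~R) by apply: mulr_ge0; lra.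
  by rewrite rmorphD /= in i_le; rewrite !tE; lra.
rewrite -tA => _ [i _ <-] ti.
have far : 1 <= `|t (j + k) - t i|.
  case: (ltgtP i (j + k)) => [/gap|/gap|ijk]; last by case: ti; rewrite ijk.
    by move=> /le_trans; apply; exact: ler_norm.
  by rewrite distrC => /le_trans; apply; exact: ler_norm.
have near : `|t j + t k - t (j + k)| < 2^-1.
  case: (tD j k) => ->; first by rewrite subrr normr0; lra.
  by rewrite addrC addKr ltr_norml; lra.
have := ler_distD (t j + t k) (t (j + k)) (t i).
by rewrite [X in _ <= X + _]distrC; lra.
Qed.
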